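(* Let $k\in\mathbb{N}$, let $n_i\in\mathbb{N}$ for $i=1,\ldots,k$, and let $m=\sum_{i=1}^k n_i$. Then for all convex functions $f\in\mathcal{C}([0,1])$ and all $x_1,\ldots,x_k\in[0,1]$ the following four inequalities hold: $$\sum_{i_1=0}^{n_1}\cdots \sum_{i_k=0}^{n_k}p_{n_1,i_1}(x_1)\cdots p_{n_k,i_k}(x_k)\, f\left(\frac{i_1+\cdots+i_k}{m}\right)\leq (B_{m}f)\left(\sum_{i=1}^k\frac{n_i}{m}\, x_i\right),$$ $$(B_{m}f)\left(\sum_{i=1}^k\frac{n_i}{m}\, x_i\right)\leq \sum_{i=1}^k\frac{n_i}{m}\,(B_{m}f)(x_i),$$ $$\sum_{i_1=0}^{n_1}\cdots \sum_{i_k=0}^{n_k}p_{n_1,i_1}(x_1)\cdots p_{n_k,i_k}(x_k)\, f\left(\frac{i_1+\cdots+i_k}{m}\right)\leq \sum_{i=1}^k\frac{n_i}{m}\,(B_mf)(x_i),$$ $$\sum_{i_1=0}^{n_1}\cdots\sum_{i_k=0}^{n_k} p_{n_1,i_1}(x_1)\cdots p_{n_k,i_k}(x_k)\, f\left(\frac{i_1+\cdots+i_k}{m}\right)\leq \sum_{i=1}^k\frac{n_i}{m}\sum_{j=0}^m p_{m,j}(x_i)\,f\left(\frac{j}{m}\right).$$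
   Context: $\mathbb{N}$ denotes the positive integers, and $\mathcal{C}([0,1])$ the continuous real-valued functions on $[0,1]$. For $n\in\mathbb{N}$, the Bernstein basic polynomials are $p_{n,i}(x)=\binom{n}{i}x^i(1-x)^{n-i}$ for $i=0,1,\dots,n$, $x\in[0,1]$ (with $0^0=1$). The Bernstein operator $B_n:\mathcal{C}([0,1])\to\mathcal{C}([0,1])$ is $(B_nf)(x)=\sum_{i=0}^n p_{n,i}(x)f\left(\frac in\right)$ for $x\in[0,1]$. *)

(* Defs.v *)
From HB Require Import structures.
From mathcomp Require Import all_boot all_order all_algebra.
From mathcomp Require Import boolp classical_sets reals topology normedtype convex.

Set Implicit Arguments.
Unset Strict Implicit.
Unset Printing Implicit Defensive.

Import Order.TTheory GRing.Theory Num.Theory.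
Import numFieldNormedType.Exports.

Local Open Scope ring_scope.

Definition bernstein_basis (R : realType) (n i : nat) (x : R) : R :=
  'C(n, i)%:R * x ^+ i * (1 - x) ^+ (n - i).

(* [f] and the result are total on R; only their values on [0, 1] matter. *)
Definition bernstein_op (R : realType) (n : nat) (f : R -> R) (x : R) : R :=
  \sum_(i < n.+1) bernstein_basis n i x * f (i%:R / n%:R).

(* Main.v *)
(* Both sides are pairings [sum_j c_j f(j/m)] of [f] with the coefficients of a
   polynomial in X: the multiple sum is the pairing with
   [prod_i (1 + x_i (X - 1))^(n_i)], and [B_m f (y)] the pairing with
   [(1 + y (X - 1))^m].  Convexity makes the pairing nonnegative on polynomials
   [(X - 1)^2 N] with [N] of nonnegative coefficients, so each inequality reduces
   to writing a difference of such polynomials in that form.  For the first one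
   (Hoeffding's comparison of a Poisson-binomial law with the binomial law of the
   same mean), two success probabilities [a <= q <= b] on either side of the mean
   [q] are replaced by [q] and [a + b - q], and one inducts on the number of
   trials; the second is convexity of [y |-> (1 + y (X - 1))^m] for the order
   defined by that cone. *)
Require Import Defs.
From HB Require Import structures.
From mathcomp Require Import all_boot all_order all_algebra.
From mathcomp Require Import boolp classical_sets reals topology normedtype convex.
From mathcomp Require Import interval_inference ring lra.

Set Implicit Arguments.
Unset Strict Implicit.
Unset Printing Implicit Defensive.

Import Order.TTheory GRing.Theory Num.Theory.
Import numFieldNormedType.Exports.

Local Open Scope classical_set_scope.
Local Open Scope ring_scope.

(** * Generating polynomials of Bernoulli trials and the cone of convexity *)

Section convex_cone.
Variable R : realFieldType.
Implicit Types (P Q A B N : {poly R}) (p q x y : R) (m d : nat).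

(** Probability generating function of one trial with success probability [p], expanded at 1 so that
    differences are visible multiples of ['X - 1]. *)
Definition bernoulli_pgf p : {poly R} := 1 + p *: ('X - 1).

Lemma bernoulli_pgfE p : bernoulli_pgf p = (1 - p)%:P + p *: 'X.
Proof. by rewrite /bernoulli_pgf scalerBr polyCB alg_polyC polyC1; ring. Qed.

Lemma bernoulli_pgfB p q :
  bernoulli_pgf p - bernoulli_pgf q = (p - q) *: ('X - 1).
Proof. by rewrite /bernoulli_pgf scalerBl; ring. Qed.

Definition nneg_poly d A := (forall i, 0 <= A`_i) /\ (size A <= d.+1)%N.

Lemma nneg_poly1 : nneg_poly 0 1.
Proof. by split=> [i|]; rewrite ?size_poly1// coef1 ler0n. Qed.

Lemma nneg_polyM d m A B :
  nneg_poly d A -> nneg_poly m B -> nneg_poly (d + m) (A * B).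
Proof.
move=> [A0 sA] [B0 sB]; split=> [i|].
  by rewrite coefM sumr_ge0// => j _; rewrite mulr_ge0.
apply: leq_trans (size_polyMleq _ _) _; rewrite -subn1 leq_subLR.
by have := leq_add sA sB; rewrite addSn addnS.
Qed.

Lemma nneg_polyX d m A : nneg_poly d A -> nneg_poly (m * d) (A ^+ m).
Proof.
move=> hA; elim: m => [|m IH]; last by rewrite exprS mulSn; apply: nneg_polyM.
by rewrite expr0; exact: nneg_poly1.
Qed.

Lemma nneg_bernoulli_pgf p : 0 <= p <= 1 -> nneg_poly 1 (bernoulli_pgf p).
Proof.
move=> /andP[p0 p1]; rewrite bernoulli_pgfE; split=> [i|].
  rewrite coefD coefC coefZ coefX addr_ge0//; first by case: ifP; rewrite ?subr_ge0.
  by rewrite mulr_ge0// ler0n.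
rewrite (leq_trans (size_polyD _ _))// geq_max size_polyC.
rewrite (leq_trans (size_scale_leq _ _)) ?size_polyX// andbT.
by case: (_ != _).
Qed.

(* The polynomials [P = sum_j c_j X^j] of degree at most [m] for which
   [sum_j c_j g(j) >= 0] is witnessed by second differences of [g]. *)
Definition convex_cone m P := exists N,
  [/\ P = N * ('X - 1) ^+ 2, forall i, 0 <= N`_i & (size N <= m.-1)%N].

Lemma convex_cone0 m : convex_cone m 0.
Proof. by exists 0; split=> [|i|]; rewrite ?mul0r ?coef0 ?size_poly0. Qed.

Lemma convex_coneD m P Q :
  convex_cone m P -> convex_cone m Q -> convex_cone m (P + Q).
Proof.
move=> [N [-> N0 sN]] [N' [-> N'0 sN']]; exists (N + N'); rewrite mulrDl; split=> // [i|].
  by rewrite coefD addr_ge0.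
by rewrite (leq_trans (size_polyD _ _))// geq_max sN.
Qed.

Lemma convex_coneZ m p P : 0 <= p -> convex_cone m P -> convex_cone m (p *: P).
Proof.
move=> p0 [N [-> N0 sN]]; exists (p *: N); rewrite scalerAl; split=> // [i|].
  by rewrite coefZ mulr_ge0.
exact: leq_trans (size_scale_leq _ _) sN.
Qed.

Lemma convex_cone_sum m (I : Type) (r : seq I) (F : I -> {poly R}) :
  (forall i, convex_cone m (F i)) -> convex_cone m (\sum_(i <- r) F i).
Proof.
move=> hF; apply: big_ind => //; [exact: convex_cone0|exact: convex_coneD].
Qed.

Lemma convex_coneM m d A P :
  nneg_poly d A -> convex_cone m P -> convex_cone (d + m) (A * P).
Proof.
move=> hA [N [-> N0 sN]].
(* A nonzero [N] forces [m >= 2], so the truncated predecessor in the size bound commutes with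
   adding [d]. *)
have [->|Nn0] := eqVneq N 0; first by rewrite mul0r mulr0; exact: convex_cone0.
have sN0 : (0 < size N)%N by rewrite size_poly_gt0.
case: m sN => [|[|m]] sN; try by rewrite leqNgt sN0 in sN.
by have [h1 h2] := nneg_polyM hA (conj N0 sN); exists (A * N); rewrite mulrA !addnS.
Qed.

Lemma convex_cone_sqr m A :
  nneg_poly m A -> convex_cone m.+2 (('X - 1) ^+ 2 * A).
Proof. by move=> [A0 sA]; exists A; rewrite mulrC. Qed.

(* First-order Taylor remainder of [x |-> (1 + x (X - 1))^m]. *)
Lemma convex_cone_tangent m x y : 0 <= x <= 1 -> 0 <= y <= 1 ->
  convex_cone m (bernoulli_pgf x ^+ m - bernoulli_pgf y ^+ m
     - (m%:R * (x - y)) *: (('X - 1) * bernoulli_pgf y ^+ m.-1)).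
Proof.
move=> hx hy; elim: m => [|[|m] IH].
- by rewrite !expr0 subrr mul0r scale0r subr0; exact: convex_cone0.
- rewrite !expr1 expr0 mulr1 mul1r bernoulli_pgfB subrr; exact: convex_cone0.
(* Multiplying the previous remainder by [bernoulli_pgf x = bernoulli_pgf y + (x - y)('X - 1)]
   leaves only a square term as correction. *)
rewrite [X in convex_cone _ X](_ : _ = bernoulli_pgf x *
     (bernoulli_pgf x ^+ m.+1 - bernoulli_pgf y ^+ m.+1
     - (m.+1%:R * (x - y)) *: (('X - 1) * bernoulli_pgf y ^+ m))
  + m.+1%:R *: ((x - y) ^+ 2 *: (('X - 1) ^+ 2 * bernoulli_pgf y ^+ m))).
  apply: convex_coneD; first exact: (convex_coneM (nneg_bernoulli_pgf hx) IH).
  apply: convex_coneZ => //; apply: convex_coneZ; [exact: sqr_ge0|].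
  apply: convex_cone_sqr.
  by have := @nneg_polyX 1 m _ (nneg_bernoulli_pgf hy); rewrite muln1.
rewrite /= -!mul_polyC !exprS.
have -> : bernoulli_pgf x = bernoulli_pgf y + (x - y)%:P * ('X - 1).
  by rewrite mul_polyC -bernoulli_pgfB addrC subrK.
move: (bernoulli_pgf y) (bernoulli_pgf y ^+ m) => A B.
rewrite -!natr1 !polyCM !polyCD !polyC1 !polyCN.
by ring.
Qed.

(* Replacing [a <= q <= b] by [q] and [a + b - q] preserves the sum and
   increases the product. *)
Lemma convex_cone_prod q (s : seq R) : 0 <= q <= 1 ->
  all (fun p => 0 <= p <= 1) s -> \sum_(p <- s) p = (size s)%:R * q ->
  convex_cone (size s)
    (bernoulli_pgf q ^+ size s - \prod_(p <- s) bernoulli_pgf p).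
Proof.
move=> hq; have [l] := ubnP (size s); elim: l s => // l IH s sl hs sums.
have q1 : nneg_poly 1 (bernoulli_pgf q) := nneg_bernoulli_pgf hq.
have [s0|s_gt0] := posnP (size s).
  by rewrite (size0nil s0) big_nil subrr; exact: convex_cone0.
have [a as_ aq] : exists2 a, a \in s & a <= q.
  apply/hasP/negPn/negP => /hasPn h.
  have : \sum_(p <- s) q < \sum_(p <- s) p.
    rewrite !big_seq; apply: ltr_sum => [|p ps]; last by rewrite ltNge h.
    by apply/hasP; case: s s_gt0 {sl hs sums h} => // p s _; exists p; rewrite mem_head.
  by rewrite sums big_const_seq count_predT iter_addr_0 mulr_natl ltxx.
move: sums sl hs s_gt0; have /perm_size -> := perm_to_rem as_.
rewrite !(perm_big _ (perm_to_rem as_))/= (perm_all _ (perm_to_rem as_))/=.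
move: (rem a s) => {as_}s; rewrite !big_cons ltnS => sums sl /andP[ha hs] _.
have [s0|s_gt0] := posnP (size s).
  move: sums; rewrite (size0nil s0) !big_nil /= addr0 mul1r mulr1 expr1 => ->.
  by rewrite subrr; exact: convex_cone0.
(* Since [a <= q], the remaining entries have mean at least [q]. *)
have [b bs bq] : exists2 b, b \in s & q <= b.
  apply/hasP/negPn/negP => /hasPn h.
  have : \sum_(p <- s) p < \sum_(p <- s) q.
    rewrite !big_seq; apply: ltr_sum => [|p ps]; last by rewrite ltNge h.
    by apply/hasP; case: s s_gt0 {sl hs sums h} => // p s _; exists p; rewrite mem_head.
  rewrite big_const_seq count_predT iter_addr_0 -mulr_natl => h'.
  have := ler_ltD aq h'; rewrite sums -natr1 mulrDl mul1r addrC ltxx//.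
move: sums sl hs s_gt0; have /perm_size -> := perm_to_rem bs.
rewrite !(perm_big _ (perm_to_rem bs))/= (perm_all _ (perm_to_rem bs))/=.
move: (rem b s) => {bs}s; rewrite !big_cons => sums sl /andP[hb hs] _.
(* From [a <= q <= b] follows [a <= c <= b], so [c] is again a probability; [c :: s] is one entry
   shorter and still has mean [q]. *)
set c := a + b - q.
have hc : 0 <= c <= 1 by rewrite /c; lra.
have /= := IH (c :: s) sl.
rewrite hc hs !big_cons => /(_ isT) IHs.
have {}IHs : convex_cone (size s).+1 (bernoulli_pgf q ^+ (size s).+1
    - bernoulli_pgf c * \prod_(p <- s) bernoulli_pgf p).
  apply: IHs; apply: (addrI q); rewrite addrA [q + c]addrC subrK -addrA sums.
  by rewrite -[(size s).+2%:R]natr1 mulrDl mul1r addrC.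
have Ps : nneg_poly (size s) (\prod_(p <- s) bernoulli_pgf p).
  elim: (s) hs => [_|p s' IHs' /= /andP[hp hs']].
    by rewrite big_nil; exact: nneg_poly1.
  by rewrite big_cons; apply: (@nneg_polyM 1); [exact: nneg_bernoulli_pgf|exact: IHs'].
(* The factors for [q, c] and for [a, b] have equal linear terms in ['X - 1]; their products differ
   by [q c - a b = (q - a)(b - q)] times the square. *)
have -> : bernoulli_pgf q ^+ (size s).+2
    - bernoulli_pgf a * (bernoulli_pgf b * \prod_(p <- s) bernoulli_pgf p) =
    bernoulli_pgf q * (bernoulli_pgf q ^+ (size s).+1
    - bernoulli_pgf c * \prod_(p <- s) bernoulli_pgf p)
    + ((q - a) * (b - q)) *: (('X - 1) ^+ 2 * \prod_(p <- s) bernoulli_pgf p).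
  rewrite !exprS /bernoulli_pgf /c -!mul_polyC !polyCM !polyCD !polyCN.
  by ring.
apply: convex_coneD; first exact: (@convex_coneM _ 1).
by apply: convex_coneZ; [rewrite mulr_ge0 ?subr_ge0|exact: convex_cone_sqr].
Qed.


Definition coef_pairing m (g : nat -> R) P := \sum_(j < m.+1) P`_j * g j.

Lemma coef_pairing_sum m g (I : Type) (r : seq I) (c : I -> R) (F : I -> {poly R}) :
  coef_pairing m g (\sum_(i <- r) c i *: F i) =
  \sum_(i <- r) c i * coef_pairing m g (F i).
Proof.
under [RHS]eq_bigr do rewrite mulr_sumr; rewrite exchange_big/=.
apply: eq_bigr => j _; rewrite coef_sum mulr_suml.
by apply: eq_bigr => i _; rewrite coefZ mulrA.
Qed.

Lemma coef_pairingB m g P Q :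
  coef_pairing m g (P - Q) = coef_pairing m g P - coef_pairing m g Q.
Proof. by rewrite -sumrB; apply: eq_bigr => j _; rewrite coefB mulrBl. Qed.

Lemma coef_pairingXn m g j : (j <= m)%N -> coef_pairing m g 'X^j = g j.
Proof.
rewrite -ltnS => jm; rewrite /coef_pairing (bigD1 (Ordinal jm))//= coefXn eqxx mul1r.
rewrite big1 ?addr0// => i; rewrite -val_eqE/= coefXn => /negPf ->.
by rewrite mul0r.
Qed.

(** Pairing with ['X^i * ('X - 1) ^+ 2] gives the second difference of [g] at [i]; the size bound on
    [N] keeps [i + 2 <= m], so the pairing truncates nothing. *)
Lemma coef_pairing_ge0 m g P :
  (forall j, (j.+2 <= m)%N -> g j.+1 *+ 2 <= g j + g j.+2) ->
  convex_cone m P -> 0 <= coef_pairing m g P.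
Proof.
move=> gconv [N [-> N0 sN]].
rewrite -[N]coefK poly_def mulr_suml.
under eq_bigr do rewrite -scalerAl.
rewrite coef_pairing_sum sumr_ge0// => i _; rewrite mulr_ge0//.
have im : (i.+2 <= m)%N by case: m {gconv} sN (leq_trans (ltn_ord i) sN) => [|[]].
have -> : 'X^i * ('X - 1) ^+ 2 = ('X^i - 'X^(i.+1)) - ('X^(i.+1) - 'X^(i.+2)) :> {poly R}.
  by rewrite !exprS; ring.
rewrite !coef_pairingB !coef_pairingXn ?(ltnW im)// ?(ltnW (ltnW im))//.
by have := gconv _ im; lra.
Qed.

Lemma ler_coef_pairing m g P Q :
  (forall j, (j.+2 <= m)%N -> g j.+1 *+ 2 <= g j + g j.+2) ->
  convex_cone m (Q - P) -> coef_pairing m g P <= coef_pairing m g Q.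
Proof. by move=> gc h; rewrite -subr_ge0 -coef_pairingB coef_pairing_ge0. Qed.

(** Average the tangent remainders at the weighted mean [p]: the linear terms cancel because the
    weighted deviations [x i - p] sum to 0. *)
Lemma convex_cone_jensen m k (w x : 'I_k -> R) :
  (forall i, 0 <= w i) -> \sum_(i < k) w i = 1 ->
  (forall i, 0 <= x i <= 1) -> 0 <= \sum_(i < k) w i * x i <= 1 ->
  convex_cone m (\sum_(i < k) w i *: bernoulli_pgf (x i) ^+ m
                 - bernoulli_pgf (\sum_(i < k) w i * x i) ^+ m).
Proof.
move=> w0 w1 hx; set p := \sum_(i < k) w i * x i => hp.
set B := bernoulli_pgf p.
rewrite [X in convex_cone _ X](_ : _ = \sum_(i < k) w i *: (bernoulli_pgf (x i) ^+ m
    - B ^+ m - (m%:R * (x i - p)) *: (('X - 1) * B ^+ m.-1))).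
  apply: convex_cone_sum => i; apply: convex_coneZ => //; exact: convex_cone_tangent.
under [RHS]eq_bigr do rewrite !scalerBr scalerA.
rewrite !sumrB -!scaler_suml w1 scale1r [X in X *: (_ * _)](_ : _ = 0).
  by rewrite scale0r subr0.
rewrite (_ : \sum_(i < k) _ = m%:R * (p - \sum_(i < k) w i * p)).
  by rewrite -mulr_suml w1 mul1r subrr mulr0.
by rewrite -sumrB mulr_sumr; apply: eq_bigr => i _; ring.
Qed.

End convex_cone.

(** * Bernstein operators and multiple sums as pairings *)

Lemma bernoulli_pgfX (R : realType) (n : nat) (x : R) :
  bernoulli_pgf x ^+ n = \sum_(i < n.+1) bernstein_basis n i x *: 'X^i.
Proof.
rewrite bernoulli_pgfE exprDn; apply: eq_bigr => i _.
rewrite exprZn -polyC_exp -scalerAr mul_polyC scalerA -scaler_nat scalerA.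
by congr (_ *: _); rewrite /bernstein_basis; ring.
Qed.

Lemma bernstein_opE (R : realType) (m : nat) (f : R -> R) (y : R) :
  bernstein_op m f y =
  coef_pairing m (fun j => f (j%:R / m%:R)) (bernoulli_pgf y ^+ m).
Proof.
rewrite bernoulli_pgfX coef_pairing_sum; apply: eq_bigr => i _.
by rewrite coef_pairingXn// -ltnS.
Qed.

(** The index type varies with the factor, so choices are encoded as families of tagged elements,
    where distributivity over a single index type applies. *)
Lemma bigA_distr_dffun (R : comPzSemiRingType) (I : finType) (T : I -> finType)
    (F : forall i, T i -> R) :
  \prod_i \sum_(j : T i) F i j =
  \sum_(a : {dffun forall i, T i}) \prod_i F i (a i).
Proof.
rewrite (reindex _ (onW_bij _ (@dffun_of_fprod_bij I T)))/=.
under [RHS]eq_bigr => t _ do under eq_bigr => i _ do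
  rewrite ffunE -[F i (t i)](ffunE (F i)).
rewrite big_fprod.
transitivity (\prod_i \sum_(j in tagged_with T i) untag 0 [ffun y => F i y] j).
  apply: eq_bigr => i _; rewrite -(big_tag (fun i => [ffun y => F i y])).
  by apply: eq_bigr => j _; rewrite ffunE.
exact: bigA_distr_big_dep.
Qed.

Lemma convex_function_midpoint (R : realType) (f : R -> R) (a b : R) :
  convex_function (`[0, 1] : set R^o) f ->
  0 <= a <= 1 -> 0 <= b <= 1 -> f ((a + b) / 2) *+ 2 <= f a + f b.
Proof.
move=> fconv ha hb.
have h0 : 0 <= 2^-1 :> R by rewrite invr_ge0.
have h1 : 2^-1 <= 1 :> R by rewrite invf_le1// ler1n.
have := fconv (Itv01 h0 h1) a b.
rewrite !inE/= !in_itv/= => /(_ ha hb).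
rewrite [X in f X <= _](_ : _ = (a + b) / 2).
  by rewrite convRE /= /unstable.onem; lra.
by rewrite [LHS]convRE /= /unstable.onem; field.
Qed.



Theorem theorem2p2 (R : realType) (k : nat) (hk : (0 < k)%N)
    (n : 'I_k -> nat) (hn : forall i : 'I_k, (0 < n i)%N)
    (m : nat) (hm : m = (\sum_(i < k) n i)%N)
    (f : R -> R) (fcont : {within `[0, 1], continuous f})
    (fconv : convex_function (`[0, 1] : set R^o) f)
    (x : 'I_k -> R) (hx : forall i : 'I_k, 0 <= x i <= 1) :
  [/\ \sum_(a : {dffun forall i : 'I_k, 'I_(n i).+1})
          (\prod_(i < k) bernstein_basis (n i) (a i) (x i)) *
          f ((\sum_(i < k) (a i : nat))%N%:R / m%:R)
      <= bernstein_op m f (\sum_(i < k) (n i)%:R / m%:R * x i),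
      bernstein_op m f (\sum_(i < k) (n i)%:R / m%:R * x i)
      <= \sum_(i < k) (n i)%:R / m%:R * bernstein_op m f (x i),
      \sum_(a : {dffun forall i : 'I_k, 'I_(n i).+1})
          (\prod_(i < k) bernstein_basis (n i) (a i) (x i)) *
          f ((\sum_(i < k) (a i : nat))%N%:R / m%:R)
      <= \sum_(i < k) (n i)%:R / m%:R * bernstein_op m f (x i)
    & \sum_(a : {dffun forall i : 'I_k, 'I_(n i).+1})
          (\prod_(i < k) bernstein_basis (n i) (a i) (x i)) *
          f ((\sum_(i < k) (a i : nat))%N%:R / m%:R)
      <= \sum_(i < k) (n i)%:R / m%:R *
           \sum_(j < m.+1) bernstein_basis m j (x i) * f (j%:R / m%:R)].
Proof.
have m_gt0 : (0 < m)%N.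
  by rewrite hm (bigD1 (Ordinal hk))//= addn_gt0 hn.
have m0 : 0 < m%:R :> R by rewrite ltr0n.
pose g j := f (j%:R / m%:R).
(* Midpoint convexity of [f] at [j/m] and [(j+2)/m]. *)
have gconv j : (j.+2 <= m)%N -> g j.+1 *+ 2 <= g j + g j.+2.
  have h01 i : (i <= m)%N -> 0 <= (i%:R / m%:R : R) <= 1.
    by move=> im; rewrite divr_ge0//= ler_pdivrMr// mul1r ler_nat.
  move=> jm; have := convex_function_midpoint fconv (h01 j _) (h01 j.+2 _).
  rewrite (ltnW (ltnW jm)) jm => /(_ isT isT).
  rewrite [(_ + _) / 2](_ : _ = j.+1%:R / m%:R)// -!natr1.
  by field; rewrite gt_eqF.
pose w i : R := (n i)%:R / m%:R.
have w0 i : 0 <= w i by rewrite divr_ge0.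
have w1 : \sum_(i < k) w i = 1.
  by rewrite -mulr_suml -natr_sum -hm divff ?gt_eqF.
set p := \sum_(i < k) _.
have hp : 0 <= p <= 1.
  apply/andP; split.
    by apply: sumr_ge0 => i _; rewrite mulr_ge0//; case/andP: (hx i).
  rewrite -w1; apply: ler_sum => i _.
  by rewrite ler_piMr//; case/andP: (hx i).
(* Expanding the product of powers, the choice [a] contributes the monomial of degree [\sum_i a i],
   which is at most [m]. *)
have E : \sum_(a : {dffun forall i : 'I_k, 'I_(n i).+1})
          (\prod_(i < k) bernstein_basis (n i) (a i) (x i)) *
          f ((\sum_(i < k) (a i : nat))%N%:R / m%:R)
    = coef_pairing m g (\prod_(i < k) bernoulli_pgf (x i) ^+ n i).
  under [in RHS]eq_bigr do rewrite bernoulli_pgfX.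
  rewrite bigA_distr_dffun.
  under [in RHS]eq_bigr do rewrite scaler_prod -expr_sum.
  rewrite coef_pairing_sum; apply: eq_bigr => a _.
  rewrite coef_pairingXn// hm; apply: leq_sum => i _.
  by rewrite -ltnS.
have i1 : coef_pairing m g (\prod_(i < k) bernoulli_pgf (x i) ^+ n i)
    <= bernstein_op m f p.
  rewrite bernstein_opE; apply: ler_coef_pairing => //.
  (* The [m] trials, [x i] repeated [n i] times; their mean is [p]. *)
  pose s := flatten [seq nseq (n i) (x i) | i <- enum 'I_k].
  have sm : size s = m.
    rewrite size_flatten /shape -map_comp sumnE big_map big_enum/= hm.
    by apply: eq_bigr => i _; rewrite size_nseq.
  have -> : \prod_(i < k) bernoulli_pgf (x i) ^+ n i = \prod_(q <- s) bernoulli_pgf q.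
    rewrite big_flatten big_map big_enum/=.
    by apply: eq_bigr => i _; rewrite big_nseq -Monoid.iteropE.
  rewrite -{1 2}sm; apply: convex_cone_prod => //.
    apply/allP => q /flattenP[_ /mapP[i _ ->]] /nseqP[-> _].
    exact: hx.
  rewrite sm big_flatten big_map big_enum/= mulr_sumr.
  apply: eq_bigr => i _; rewrite big_nseq iter_addr_0 -mulr_natl.
  by field; rewrite gt_eqF.
have i2 : bernstein_op m f p <= \sum_(i < k) w i * bernstein_op m f (x i).
  under eq_bigr do rewrite bernstein_opE.
  rewrite bernstein_opE -coef_pairing_sum.
  by apply: ler_coef_pairing => //; exact: convex_cone_jensen.
(* The fourth inequality is the third with [bernstein_op] unfolded. *)
by rewrite E; split=> //; exact: le_trans i1 i2.
Qed.
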